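(* Let $k\ge 2$ be an integer, let $n$ be a $k$-multiperfect number and let $m$ be a $(k+1)$-multiperfect number such that $n\mid m$. If $n$ is $k$-layered, then $m$ is $(k+1)$-layered.
   Context: $\sigma(n)$ denotes the sum of the positive divisors of $n$. For an integer $k\ge 2$, a positive integer $n$ is $k$-multiperfect if $\sigma(n)=kn$. A positive integer $n$ is $k$-layered if the set of all positive divisors of $n$ can be partitioned into $k$ subsets having the same sum of elements. *)

(* Defs.v *)
From mathcomp Require Import all_boot.

Set Implicit Arguments.
Unset Strict Implicit.
Unset Printing Implicit Defensive.

Definition sigma (n : nat) : nat := \sum_(d <- divisors n) d.

Definition multiperfect (k n : nat) : Prop := 0 < n /\ sigma n = k * n.

(* The divisors of n > 0 all lie in {0, ..., n}, carried by 'I_n.+1. *)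
Definition divisor_set (n : nat) : {set 'I_n.+1} :=
  [set d : 'I_n.+1 | (d : nat) \in divisors n].

(* [partition] requires nonempty blocks; this loses nothing, since k subsets
   with a common sum and total sigma n > 0 are all nonempty. *)
Definition layered (k n : nat) : Prop :=
  0 < n /\
  exists P : {set {set 'I_n.+1}},
    [/\ partition P (divisor_set n),
        #|P| = k
      & {in P &, forall A B : {set 'I_n.+1},
           \sum_(d in A) (d : nat) = \sum_(d in B) (d : nat)}].

(* Main.v *)
Require Import Defs.
From mathcomp Require Import all_boot.

(* Put m = t * n. Multiplying the k blocks of n by t gives k disjoint sets of
   divisors of m, each with sum t * n = m. Since sigma m = (k + 1) * m, the
   divisors of m left over also have sum m and form the last block. *)

(** Both sums run over each divisor once: a divisor of [n > 0] is at most [n], so none falls outside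
    ['I_n.+1]. *)
Lemma sum_divisor_set (n : nat) :
  0 < n -> \sum_(d in divisor_set n) (d : nat) = sigma n.
Proof.
move=> n_gt0; under eq_bigl do rewrite inE.
rewrite -(big_mkord (fun d => d \in divisors n) id) -big_filter.
apply/perm_big/uniq_perm; rewrite ?filter_uniq ?iota_uniq ?divisors_uniq //.
move=> d; rewrite mem_filter mem_index_iota ltnS /=.
by apply: andb_idr; rewrite -dvdn_divisors //; apply: dvdn_leq.
Qed.

(** The [k] blocks have equal sums adding up to [sigma n = k * n]; cancelling [k] leaves [n] for
    each. *)
Lemma sum_layer (k n : nat) (P : {set {set 'I_n.+1}}) :
    0 < k -> multiperfect k n -> partition P (divisor_set n) -> #|P| = k ->
    {in P &, forall A B : {set 'I_n.+1},
       \sum_(d in A) (d : nat) = \sum_(d in B) (d : nat)} ->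
  {in P, forall A : {set 'I_n.+1}, \sum_(d in A) (d : nat) = n}.
Proof.
move=> k_gt0 [n_gt0 sigma_n] partP cardP eqsumP A AP.
apply/eqP; rewrite -(eqn_pmul2l k_gt0) -sigma_n -sum_divisor_set //.
rewrite (set_partition_big _ partP) -cardP -sum_nat_const.
by apply/eqP/eq_bigr => B BP; apply: eqsumP.
Qed.

Theorem proposition6p19 (k n m : nat) (hk : 2 <= k)
  (hn : multiperfect k n) (hm : multiperfect k.+1 m) (hnm : n %| m)
  (hlay : layered k n) : layered k.+1 m.
Proof.
have [[n_gt0 _] [m_gt0 sigma_m]] := (hn, hm).
have [_ [P [partP cardP eqsumP]]] := hlay.
have sumP := sum_layer _ _ _ (ltnW hk) hn partP cardP eqsumP.
have /dvdnP[t Dm] := hnm.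
have t_gt0 : 0 < t by move: m_gt0; rewrite Dm muln_gt0 => /andP[].
(* The default value of [inord] never occurs, since [d <= n] gives [t * d <= t * n = m]. *)
pose f (d : 'I_n.+1) : 'I_m.+1 := inord (t * d).
have val_f d : f d = t * d :> nat.
  by rewrite inordK // ltnS Dm leq_mul2l -ltnS ltn_ord orbT.
have f_inj : injective f.
  move=> d e /(congr1 val) /eqP; rewrite /= !val_f eqn_pmul2l //.
  by move/eqP/val_inj.
have sum_f (A : {set 'I_n.+1}) :
    \sum_(d in f @: A) (d : nat) = t * \sum_(d in A) (d : nat).
  rewrite big_imset /=; last exact: in2W.
  by rewrite big_distrr; apply: eq_bigr => d _; rewrite val_f.
pose Q : {set {set 'I_m.+1}} := [set f @: A | A : {set 'I_n.+1} in P].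
pose D := f @: divisor_set n.
have partQ : partition Q D by rewrite imset_partition.
have cardQ : #|Q| = k by rewrite card_imset //; apply: imset_inj.
have sumQ : {in Q, forall A : {set 'I_m.+1}, \sum_(d in A) (d : nat) = m}.
  by move=> _ /imsetP[A AP ->]; rewrite sum_f sumP.
have subD : D \subset divisor_set m.
  apply/subsetP=> _ /imsetP[d + ->].
  by rewrite !inE -!dvdn_divisors // val_f Dm dvdn_pmul2l.
pose B := divisor_set m :\: D.
(* Of the total [sigma m = k.+1 * m], the [k] blocks of [Q] take [k * m]. *)
have sumB : \sum_(d in B) (d : nat) = m.
  have := sum_divisor_set m m_gt0.
  rewrite (big_setID D) /= (setIidPr subD) -/B sigma_m (set_partition_big _ partQ).
  rewrite (eq_bigr _ sumQ) sum_nat_const cardQ mulSn addnC.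
  exact: addIn.
(* Blocks of a [partition] must be nonempty; here the sum of [B] is [m > 0]. *)
have B_neq0 : B != set0.
  by apply: contraTneq m_gt0 => B0; rewrite -sumB B0 big_set0.
have disBD : [disjoint B & D] by rewrite -setI_eq0 setIDAC setDIl setDv setI0.
(* Needed to count [k.+1] blocks. A block of [Q] lies inside [D], and [B] is disjoint from [D], so
   [B] in [Q] would force [B] to be empty. *)
have BnQ : B \notin Q.
  apply: contra B_neq0 => BQ.
  by rewrite -(setIidPl (partitionS partQ BQ)) setI_eq0.
split=> //; exists (B |: Q); split.
- have -> : divisor_set m = B :|: D.
    by rewrite setUC -[LHS](setID _ D) (setIidPr subD).
  exact: partitionU1.
- by rewrite cardsU1 BnQ cardQ.
- have sumBQ : {in B |: Q, forall A : {set 'I_m.+1}, \sum_(d in A) (d : nat) = m}.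
    by move=> A /setU1P[->|/sumQ].
  by move=> A C AP CP; rewrite !sumBQ.
Qed.
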